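(* Let $\theta, a:\mathbb{R}\to\mathbb{R}$ be $C^\infty$ functions and let $\mathcal{L}=\{L_{(\theta(t),a(t))}\}_{t\in\mathbb{R}}$ be the associated straight line family in the plane $\mathbb{R}^2$. Suppose that the Gauss mapping $\nu:\mathbb{R}\to S^1$ of $\mathcal{L}$ is non-singular. Then the unique envelope created by $\mathcal{L}$ is the mapping $$\mathbb{R}\ni t\mapsto a(t)\left(\cos\theta(t),\sin\theta(t)\right)+\left(\frac{\frac{da}{dt}(t)}{\frac{d\theta}{dt}(t)}\right)\left(-\sin\theta(t),\cos\theta(t)\right)\in\mathbb{R}^2.$$
   Context: For $C^\infty$ functions $\theta,a:\mathbb{R}\to\mathbb{R}$, the straight line family $\mathcal{L}=\{L_{(\theta(t),a(t))}\}_{t\in\mathbb{R}}$ consists of the lines $L_{(\theta(t),a(t))}=\{(X,Y)\in\mathbb{R}^2 \mid X\cos\theta(t)+Y\sin\theta(t)=a(t)\}$. Its Gauss mapping is $\nu:\mathbb{R}\to S^1$, $\nu(t)=(\cos\theta(t),\sin\theta(t))$. A point $t$ is a regular point of $\nu$ if $\frac{d\nu}{dt}(t)\neq 0$ (equivalently $\frac{d\theta}{dt}(t)\ne 0$), and a singular point otherwise; $\nu$ is non-singular if every $t\in\mathbb{R}$ is a regular point. An envelope created by $\mathcal{L}$ is a $C^\infty$ mapping $f:\mathbb{R}\to\mathbb{R}^2$ such that for every $t\in\mathbb{R}$: (a) $\frac{df}{dt}(t)\cdot\nu(t)=0$ (standard scalar product), and (b) $f(t)\in L_{(\theta(t),a(t))}$.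 *)

(* Defs.v *)
From Stdlib Require Import Reals.
From Coquelicot Require Import Coquelicot.

Open Scope R_scope.

(* [Derive] is a total function, so smoothness is stated through the
   differentiability predicate [ex_derive_n] at every order and every point. *)
Definition smooth (g : R -> R) : Prop :=
  forall (n : nat) (t : R), ex_derive_n g n t.

Definition smooth_curve (f : R -> R * R) : Prop :=
  smooth (fun t => fst (f t)) /\ smooth (fun t => snd (f t)).

(* Velocity of a plane curve; only meaningful for differentiable [f]. *)
Definition velocity (f : R -> R * R) (t : R) : R * R :=
  (Derive (fun s => fst (f s)) t, Derive (fun s => snd (f s)) t).

Definition dot (u v : R * R) : R := fst u * fst v + snd u * snd v.

Definition line (theta a : R) (P : R * R) : Prop :=
  fst P * cos theta + snd P * sin theta = a.

Definition line_family (theta a : R -> R) (t : R) : R * R -> Prop :=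
  line (theta t) (a t).

Definition gauss (theta : R -> R) (t : R) : R * R :=
  (cos (theta t), sin (theta t)).

Definition regular_point (nu : R -> R * R) (t : R) : Prop :=
  velocity nu t <> (0, 0).

Definition non_singular (nu : R -> R * R) : Prop :=
  forall t : R, regular_point nu t.

Definition is_envelope (theta a : R -> R) (f : R -> R * R) : Prop :=
  smooth_curve f /\
  forall t : R,
    dot (velocity f t) (gauss theta t) = 0 /\ line_family theta a t (f t).

(* The sum and scalings are those of Coquelicot's product module on [R * R]. *)
Definition envelope_map (theta a : R -> R) (t : R) : R * R :=
  plus (scal (a t) (cos (theta t), sin (theta t)))
       (scal (Derive a t / Derive theta t) (- sin (theta t), cos (theta t))).

(* Main.v *)
Require Import Defs.
From Stdlib Require Import Reals Lra.
From Coquelicot Require Import Coquelicot.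
Open Scope R_scope.

(** Write [nu = (cos theta, sin theta)] and [mu = (- sin theta, cos theta)], an
    orthonormal moving frame with [nu' = theta' mu] and [mu' = - theta' nu].
    A curve [f] lies on the lines of the family exactly when [f . nu = a].
    Differentiating this gives [f' . nu + theta' (f . mu) = a'], so that [f] is
    an envelope only if [theta' (f . mu) = a'].  As [nu] is non-singular,
    [theta'] never vanishes; hence both coordinates of [f] in the frame are
    forced, [f . nu = a] and [f . mu = a' / theta'], which is uniqueness
    ([envelope_mu_coordinate], [frame_expansion]).

    Conversely, for [f = a nu + b mu] with [b = a' / theta'], the component of
    [f'] along [nu] is [a' - b theta' = 0] ([frame_curve_velocity]).

    What remains is that [f] is smooth.  Instead of Leibniz-type formulas for
    the higher derivatives, the proof uses a coinductive argument: a set of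
    functions each of which has a derivative inside the set consists of smooth
    functions ([smooth_of_derivation_closed]).  The set generated from the
    smooth functions by sums, opposites, products, inverses of non-vanishing
    functions, [cos] and [sin] is such a set, because the differentiation rules
    for these operations use no others
    ([generated_derivation_closed]). *)

(** * Differentiation rules and smooth functions *)

Lemma is_derive_Rplus (g h : R -> R) (t g' h' : R) :
  is_derive g t g' -> is_derive h t h' ->
  is_derive (fun s => g s + h s) t (g' + h').
Proof. exact (is_derive_plus g h t g' h'). Qed.

Lemma is_derive_Ropp (g : R -> R) (t g' : R) :
  is_derive g t g' -> is_derive (fun s => - g s) t (- g').
Proof. exact (is_derive_opp g t g'). Qed.

Lemma is_derive_cos_comp (g : R -> R) (t g' : R) :
  is_derive g t g' -> is_derive (fun s => cos (g s)) t (g' * - sin (g t)).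
Proof. apply (is_derive_comp cos g), is_derive_cos. Qed.

Lemma is_derive_sin_comp (g : R -> R) (t g' : R) :
  is_derive g t g' -> is_derive (fun s => sin (g s)) t (g' * cos (g t)).
Proof. apply (is_derive_comp sin g), is_derive_sin. Qed.

Lemma is_derive_Rmult (g h : R -> R) (t g' h' : R) :
  is_derive g t g' -> is_derive h t h' ->
  is_derive (fun s => g s * h s) t (g' * h t + g t * h').
Proof.
  intros Dg Dh. apply (is_derive_mult g h); auto. intros; apply Rmult_comm.
Qed.

Lemma smooth_is_derive (g : R -> R) :
  smooth g -> forall t, is_derive g t (Derive g t).
Proof. intros Hg t. apply Derive_correct. exact (Hg 1%nat t). Qed.

Lemma Derive_n_Derive (g : R -> R) (n : nat) (t : R) :
  Derive_n (Derive g) n t = Derive_n g (S n) t.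
Proof.
  change (Derive g) with (Derive_n g 1).
  now rewrite Derive_n_comp, Nat.add_1_r.
Qed.

Lemma smooth_Derive (g : R -> R) : smooth g -> smooth (Derive g).
Proof.
  intros Hg [|n] t; [exact I|].
  apply ex_derive_ext with (Derive_n g (S n)).
  - intros s. symmetry. apply Derive_n_Derive.
  - exact (Hg (S (S n)) t).
Qed.

(** The derivative provided by the hypothesis agrees with [Derive g] pointwise
    and lies again in [A], so that the [n]-th derivative of [g] is, pointwise,
    the [(n-1)]-st derivative of a member of [A]. *)
Lemma smooth_of_derivation_closed (A : (R -> R) -> Prop) :
  (forall g, A g -> exists g', A g' /\ forall t, is_derive g t (g' t)) ->
  forall g, A g -> smooth g.
Proof.
  intros Hclosed g Ag n; revert g Ag.
  induction n as [|n IH]; intros g Ag t; [exact I|].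
  destruct (Hclosed g Ag) as [g' [Ag' Hg']].
  destruct n as [|n]; [exists (g' t); apply Hg'|].
  apply ex_derive_ext with (Derive_n g' n); [|exact (IH g' Ag' t)].
  intros s. rewrite <- Derive_n_Derive.
  apply Derive_n_ext. intros u. symmetry. now apply is_derive_unique.
Qed.

Inductive generated : (R -> R) -> Prop :=
| gen_smooth g : smooth g -> generated g
| gen_opp g : generated g -> generated (fun t => - g t)
| gen_plus g h : generated g -> generated h -> generated (fun t => g t + h t)
| gen_mult g h : generated g -> generated h -> generated (fun t => g t * h t)
| gen_inv g : (forall t, g t <> 0) -> generated g -> generated (fun t => / g t)
| gen_cos g : generated g -> generated (fun t => cos (g t))
| gen_sin g : generated g -> generated (fun t => sin (g t)).

(** Each differentiation rule expresses the derivative through the operands,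
    which are generated, and their derivatives, which are generated by
    induction. *)
Lemma generated_derivation_closed (g : R -> R) :
  generated g -> exists g', generated g' /\ forall t, is_derive g t (g' t).
Proof.
  induction 1 as [g Hg | g Hg [g' [Gg' Dg]]
    | g h Hg [g' [Gg' Dg]] Hh [h' [Gh' Dh]]
    | g h Hg [g' [Gg' Dg]] Hh [h' [Gh' Dh]]
    | g nz Hg [g' [Gg' Dg]]
    | g Hg [g' [Gg' Dg]] | g Hg [g' [Gg' Dg]]].
  - exists (Derive g). split.
    + now apply gen_smooth, smooth_Derive.
    + now apply smooth_is_derive.
  - exists (fun t => - g' t). split; [now apply gen_opp|].
    intros t. now apply is_derive_Ropp.
  - exists (fun t => g' t + h' t). split; [now apply gen_plus|].
    intros t. now apply is_derive_Rplus.
  - exists (fun t => g' t * h t + g t * h' t). split.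
    + apply gen_plus; now apply gen_mult.
    + intros t. now apply is_derive_Rmult.
  - exists (fun t => - g' t * (/ g t * / g t)). split.
    + apply gen_mult; [now apply gen_opp|].
      apply gen_mult; now apply gen_inv.
    + intros t.
      replace (- g' t * (/ g t * / g t)) with (- g' t / g t ^ 2)
        by (field; apply nz).
      now apply is_derive_inv.
  - exists (fun t => g' t * - sin (g t)). split.
    + apply gen_mult; [assumption|]. now apply gen_opp, gen_sin.
    + intros t. now apply is_derive_cos_comp.
  - exists (fun t => g' t * cos (g t)). split.
    + apply gen_mult; [assumption|]. now apply gen_cos.
    + intros t. now apply is_derive_sin_comp.
Qed.

Lemma generated_is_smooth (g : R -> R) : generated g -> smooth g.
Proof.
  apply smooth_of_derivation_closed. exact generated_derivation_closed.
Qed.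

(** * The moving frame *)

Lemma cos2_sin2 (x : R) : cos x * cos x + sin x * sin x = 1.
Proof. rewrite Rplus_comm. exact (sin2_cos2 x). Qed.

Lemma velocity_unique (x y : R -> R) (t x' y' : R) :
  is_derive x t x' -> is_derive y t y' ->
  velocity (fun s => (x s, y s)) t = (x', y').
Proof.
  intros Dx Dy. unfold velocity. cbn [fst snd].
  f_equal; now apply is_derive_unique.
Qed.

(** The velocity of [nu] is [theta' mu], which vanishes with [theta']. *)
Lemma regular_point_Derive_neq_0 (theta : R -> R) (t : R) :
  ex_derive theta t -> regular_point (gauss theta) t -> Derive theta t <> 0.
Proof.
  intros Dtheta Hreg H0. apply Hreg. apply Derive_correct in Dtheta.
  unfold gauss.
  rewrite (velocity_unique _ _ _ _ _ (is_derive_cos_comp _ _ _ Dtheta)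
             (is_derive_sin_comp _ _ _ Dtheta)).
  rewrite H0. f_equal; ring.
Qed.

(** Of the four terms of [(p nu + q mu)'], the terms [p theta' mu] and [q' mu]
    are orthogonal to [nu]; what is left is [p' nu] and [- q theta' nu]. *)
Lemma frame_curve_velocity (theta p q : R -> R) (t theta' p' q' : R) :
  is_derive theta t theta' -> is_derive p t p' -> is_derive q t q' ->
  dot (velocity (fun s => (p s * cos (theta s) + q s * - sin (theta s),
                           p s * sin (theta s) + q s * cos (theta s))) t)
      (gauss theta t) = p' - q t * theta'.
Proof.
  intros Dtheta Dp Dq.
  pose proof (is_derive_cos_comp _ _ _ Dtheta) as Dcos.
  pose proof (is_derive_sin_comp _ _ _ Dtheta) as Dsin.
  rewrite (velocity_unique _ _ _ _ _
    (is_derive_Rplus _ _ _ _ _ (is_derive_Rmult _ _ _ _ _ Dp Dcos)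
       (is_derive_Rmult _ _ _ _ _ Dq (is_derive_Ropp _ _ _ Dsin)))
    (is_derive_Rplus _ _ _ _ _ (is_derive_Rmult _ _ _ _ _ Dp Dsin)
       (is_derive_Rmult _ _ _ _ _ Dq Dcos))).
  unfold dot, gauss; cbn [fst snd].
  transitivity ((p' - q t * theta') *
    (cos (theta t) * cos (theta t) + sin (theta t) * sin (theta t))); [ring|].
  rewrite cos2_sin2. ring.
Qed.

(** Differentiate [f . nu = a] and drop the term [f' . nu], which is zero. *)
Lemma envelope_mu_coordinate (theta a : R -> R) (f : R -> R * R) (t : R) :
  ex_derive theta t -> is_envelope theta a f ->
  Derive theta t * (fst (f t) * - sin (theta t) + snd (f t) * cos (theta t))
  = Derive a t.
Proof.
  intros Dtheta [[Hx Hy] Henv]. apply Derive_correct in Dtheta.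
  pose proof (is_derive_Rplus _ _ _ _ _
      (is_derive_Rmult _ _ _ _ _ (smooth_is_derive _ Hx t)
         (is_derive_cos_comp _ _ _ Dtheta))
      (is_derive_Rmult _ _ _ _ _ (smooth_is_derive _ Hy t)
         (is_derive_sin_comp _ _ _ Dtheta))) as Da.
  apply (is_derive_ext _ a) in Da; [|intros s; exact (proj2 (Henv s))].
  apply is_derive_unique in Da.
  pose proof (proj1 (Henv t)) as Hdot.
  unfold dot, velocity, gauss in Hdot; cbn [fst snd] in Hdot.
  lra.
Qed.

Lemma frame_expansion (x y c : R) :
  (x, y) =
  ((x * cos c + y * sin c) * cos c + (x * - sin c + y * cos c) * - sin c,
   (x * cos c + y * sin c) * sin c + (x * - sin c + y * cos c) * cos c).
Proof.
  f_equal.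
  - transitivity (x * (cos c * cos c + sin c * sin c)); [|ring].
    rewrite cos2_sin2. ring.
  - transitivity (y * (cos c * cos c + sin c * sin c)); [|ring].
    rewrite cos2_sin2. ring.
Qed.

(** * The envelope *)

Theorem corollary3 (theta a : R -> R)
  (smooth_theta : smooth theta) (smooth_a : smooth a)
  (gauss_non_singular : non_singular (gauss theta)) :
  is_envelope theta a (envelope_map theta a) /\
  (forall f : R -> R * R,
     is_envelope theta a f -> forall t : R, f t = envelope_map theta a t).
Proof.
  assert (theta'_neq_0 : forall t, Derive theta t <> 0).
  { intros t. apply regular_point_Derive_neq_0; [|apply gauss_non_singular].
    exact (smooth_theta 1%nat t). }
  set (b := fun t => Derive a t * / Derive theta t).
  assert (Gb : generated b).
  { apply gen_mult; [|apply gen_inv; [assumption|]];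
      now apply gen_smooth, smooth_Derive. }
  change (envelope_map theta a) with
    (fun s => (a s * cos (theta s) + b s * - sin (theta s),
               a s * sin (theta s) + b s * cos (theta s))).
  split.
  - split.
    + pose proof (gen_smooth a smooth_a) as Ga.
      pose proof (gen_smooth theta smooth_theta) as Gtheta.
      split; apply generated_is_smooth.
      * apply gen_plus; apply gen_mult; trivial; [now apply gen_cos|].
        now apply gen_opp, gen_sin.
      * apply gen_plus; apply gen_mult; trivial; [now apply gen_sin|].
        now apply gen_cos.
    + intros t. split.
      * rewrite (frame_curve_velocity theta a b t _ _ _
          (smooth_is_derive _ smooth_theta t) (smooth_is_derive _ smooth_a t)
          (smooth_is_derive _ (generated_is_smooth _ Gb) t)).
        unfold b. field. apply theta'_neq_0.
      * unfold line_family, line; cbn [fst snd].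
        transitivity (a t * (cos (theta t) * cos (theta t)
                             + sin (theta t) * sin (theta t))); [ring|].
        rewrite cos2_sin2. ring.
  - intros f Hf t.
    pose proof (envelope_mu_coordinate theta a f t (smooth_theta 1%nat t) Hf)
      as Hmu.
    pose proof (proj2 (proj2 Hf t)) as Hnu.
    unfold line_family, line in Hnu.
    rewrite (surjective_pairing (f t)).
    rewrite (frame_expansion _ _ (theta t)), Hnu.
    replace (b t) with
      (fst (f t) * - sin (theta t) + snd (f t) * cos (theta t)); [reflexivity|].
    unfold b. rewrite <- Hmu. field. apply theta'_neq_0.
Qed.
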